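(* Let $(X,G)$ be a complete $G$-metric space with $|X|\geq 3$. Let $T: X\to X$ be a mapping satisfying the following conditions: (I) for all $x\in X$, $T(Tx)\neq x$ provided $Tx\neq x$; (II) there exist nonnegative constants $a_1,a_2,a_3,a_4$ with $0<\sum_{i=1}^4 a_i<1$ such that for all pairwise distinct points $x,y,z\in X$, $$G(Tx,Ty,Tz)\leq a_1G(x,Tx,Tx)+a_2G(y,Ty,Ty)+a_3G(z,Tz,Tz)+a_4G(x,y,z).$$ Then $\operatorname{Fix}(T)\neq\emptyset$ and $|\operatorname{Fix}(T)|\leq 2$.
   Context: $X$ is a nonempty set, $|X|$ denotes its cardinality, and $\operatorname{Fix}(T)=\{x\in X: Tx=x\}$. Write $\mathbb{R}^+=[0,\infty)$. A mapping $G: X\times X\times X\to \mathbb{R}^+$ is a $G$-metric on $X$, and $(X,G)$ is a $G$-metric space, if for all $x,y,z,w\in X$: (P1) $G(x,y,z)=0$ if and only if $x=y=z$; (P2) if $x\neq y$, then $G(x,x,y)>0$; (P3) $G$ is invariant under every permutation of its three arguments; (P4) if $y\neq z$, then $G(x,x,y)\leq G(x,y,z)$; (P5) $G(x,y,z)\leq G(x,w,w)+G(w,y,z)$. A sequence $\{x_n\}$ in $X$ is $G$-convergent to $x\in X$ if $\lim_{n,m\to\infty}G(x_n,x_m,x)=0$. It is $G$-Cauchy if $\lim_{n,m\to\infty}G(x_n,x_m,x_m)=0$. $(X,G)$ is complete if every $G$-Cauchy sequence in $X$ is $G$-convergent to an element of $X$. *)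

(* Defs.v *)
From HB Require Import structures.
From mathcomp Require Import all_boot all_order all_algebra.
From mathcomp Require Import all_classical all_reals all_analysis.

Set Implicit Arguments.
Unset Strict Implicit.
Unset Printing Implicit Defensive.

Import Order.TTheory GRing.Theory Num.Theory.
Import numFieldNormedType.Exports.

Local Open Scope classical_set_scope.
Local Open Scope ring_scope.

Section GMetric.
Context {R : realType} {X : Type}.
Implicit Types (G : X -> X -> X -> R) (u : nat -> X) (l : X).

Record is_Gmetric G : Prop := IsGmetric {
  Gmetric_ge0 : forall x y z, 0 <= G x y z ;
  Gmetric_eq0 : forall x y z, G x y z = 0 <-> x = y /\ y = z ;
  Gmetric_gt0 : forall x y, x <> y -> 0 < G x x y ;
  Gmetric_sym : forall x y z,
    [/\ G x z y = G x y z, G y x z = G x y z, G y z x = G x y z,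
        G z x y = G x y z & G z y x = G x y z] ;
  Gmetric_le : forall x y z, y <> z -> G x x y <= G x y z ;
  Gmetric_triangle : forall x y z w, G x y z <= G x w w + G w y z
}.

(* The limits are genuine double limits: [(\oo, \oo)] is the product filter,
   so the two indices tend to infinity independently of each other. *)
Definition Gconvergent G u l :=
  G (u nm.1) (u nm.2) l @[nm --> (\oo, \oo)] --> (0 : R).

Definition Gcauchy G u :=
  G (u nm.1) (u nm.2) (u nm.2) @[nm --> (\oo, \oo)] --> (0 : R).

Definition Gcomplete G :=
  forall u, Gcauchy G u -> exists l, Gconvergent G u l.

Definition Fix (T : X -> X) : set X := [set x | T x = x].

End GMetric.

(* Main.v *)
Require Import Defs.
From HB Require Import structures.
From mathcomp Require Import all_boot all_order all_algebra.
From mathcomp Require Import all_classical all_reals all_analysis.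
From mathcomp Require Import lra.
Import Order.TTheory GRing.Theory Num.Theory.
Import numFieldNormedType.Exports.
Local Open Scope card_scope.
Local Open Scope classical_set_scope.
Local Open Scope ring_scope.

(** The key quantity is the perimeter [G y (T y) (T (T y))] of three
    consecutive iterates.

    The hypothesis bounds a symmetric quantity by an asymmetric one, so
    averaging it over the cyclic permutations of [x, y, z] replaces each of
    [a1, a2, a3] by their mean [b] ([averaged_Reich]); with [c = a4] the
    constraint on the sum becomes [3 * b + c < 1].

    If [T] has no fixed point, three consecutive iterates are always pairwise
    distinct, by the exclusion of 2-cycles, and each [G y (T y) (T y)] on the
    right-hand side is at most the perimeter of a triple containing [y] and
    [T y].  This yields a contraction of the perimeter along the orbit by the
    ratio [(2 * b + c) / (1 - b) < 1] ([perimeter_contract]).  Two consequences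
    follow: the orbit is Cauchy, hence converges to some [l]
    ([Gcauchy_geometric]), and it never repeats a value, since its perimeters
    strictly decrease ([iter_inj]).  So from some rank on the orbit avoids [l],
    and the hypothesis applies to [l] and two consecutive iterates; in the
    limit it reads [G l l (T l) <= b * G l (T l) (T l)].

    The two sides differ: [G] need not satisfy [G x x y = G x y y], only
    [G x y y <= 2 * G x x y].  This is where averaging is essential, for
    [b < 1/3] leaves room for the factor 2 and forces [T l = l].

    Uniqueness up to two points is immediate: three distinct fixed points would
    satisfy [G x y z <= c * G x y z] with [c < 1] and [0 < G x y z]. *)

(** * Metric and set-theoretic preliminaries *)

Lemma card_le_I2 (X : Type) (A : set X) :
  (forall x y z, A x -> A y -> A z -> x <> y -> y <> z -> x <> z -> False) ->
  A #<= `I_2.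
Proof.
move=> A2; have [[p Ap]|nA] := pselect (A !=set0); last first.
  have -> : A = set0 by rewrite -subset0 => x Ax; apply: nA; exists x.
  exact: card_ge0.
have [q Aq] : exists q, forall x, A x -> x = p \/ x = q.
  have [[q [Aq qp]]|nq] := pselect (exists q, A q /\ q <> p).
    exists q => x Ax; have [->|xp] := pselect (x = p); first by left.
    have [->|xq] := pselect (x = q); first by right.
    by case: (A2 x p q) => // /esym.
  exists p => x Ax; left; have [//|xp] := pselect (x = p).
  by case: nq; exists x.
apply: (@card_le_trans _ _ _ ((fun i => if i is 0%N then p else q) @` `I_2));
  last exact: card_image_le.
by apply: subset_card_le => x /Aq[->|->]; [exists 0%N | exists 1%N].
Qed.

Lemma cvg_nat2_0P (R : realType) (f : nat -> nat -> R) :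
  (f nm.1 nm.2 @[nm --> (\oo, \oo)] --> (0 : R)) <->
  forall e, 0 < e -> exists N, forall n m, (N <= n)%N -> (N <= m)%N ->
    `|f n m| < e.
Proof.
split=> [/cvgr0Pnorm_lt f0 e /f0 [[A B] /= [[N _ NA] [M _ MB]] AB]|f0].
  exists (maxn N M) => n m; rewrite !geq_max => /andP[Nn _] /andP[_ Mm].
  by apply: (AB (n, m)); split; [apply: NA | apply: MB].
apply/cvgr0Pnorm_lt => e /f0 [N NP].
exists ([set n | (N <= n)%N], [set n | (N <= n)%N]); first by split; exists N.
by move=> [n m] /= [? ?]; exact: NP.
Qed.

Lemma inj_eventually_neq (X : Type) (u : nat -> X) (l : X) :
  injective u -> exists N, forall n, (N <= n)%N -> u n <> l.
Proof.
move=> u_inj; have [[k uk]|nl] := pselect (exists k, u k = l).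
  by exists k.+1 => n kn; rewrite -uk => /u_inj nk; rewrite nk ltnn in kn.
by exists 0%N => n _ un; apply: nl; exists n.
Qed.

Section GmetricTheory.
Context {R : realType} {X : Type} {G : X -> X -> X -> R} (HG : is_Gmetric G).

Lemma GmetricCA x y z : G y x z = G x y z.
Proof. by case: (Gmetric_sym HG x y z). Qed.

Lemma GmetricR x y z : G y z x = G x y z.
Proof. by case: (Gmetric_sym HG x y z). Qed.

Lemma Gmetric_distinct_gt0 x y z : x <> y -> 0 < G x y z.
Proof.
move=> xy; rewrite lt0r (Gmetric_ge0 HG) andbT.
by apply/eqP => /(Gmetric_eq0 HG)[].
Qed.

Lemma Gmetric_swap_le x y : G x y y <= 2 * G y x x.
Proof.
have := Gmetric_triangle HG y x y x.
by rewrite (GmetricCA x y y) (GmetricR y x x); lra.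
Qed.

Lemma Gmetric_edge_le x y z : x <> z -> G x y y <= G x y z.
Proof.
by move=> xz; rewrite -(GmetricCA x y z) -(GmetricR x y y); exact: Gmetric_le.
Qed.

(** The bound [(1 - k) * G (u n) (u m) (u m) <= c * (k ^+ n - k ^+ m)] for
    [n <= m] is the partial geometric sum in a form that telescopes under the
    triangle inequality; the case [m <= n] costs a factor 2, because
    [G x y y] is not symmetric in [x] and [y]. *)
Lemma Gcauchy_geometric (u : nat -> X) (k c : R) : 0 <= k < 1 -> 0 <= c ->
  (forall n, G (u n) (u n.+1) (u n.+1) <= k ^+ n * c) -> Gcauchy G u.
Proof.
move=> /andP[k0 k1] c0 uS.
have tele n p : (1 - k) * G (u n) (u (n + p)%N) (u (n + p)%N)
    <= c * (k ^+ n - k ^+ (n + p)).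
  elim: p => [|p IH].
    rewrite addn0 subrr mulr0.
    by rewrite (_ : G _ _ _ = 0) ?mulr0//; apply/(Gmetric_eq0 HG).
  rewrite addnS exprS.
  set q := (n + p)%N in IH *.
  have tri := Gmetric_triangle HG (u n) (u q.+1) (u q.+1) (u q).
  have := uS q.
  have k1' : 0 <= 1 - k by lra.
  move=> /(ler_wpM2l k1').
  move: tri => /(ler_wpM2l k1').
  lra.
have bound n m : (1 - k) * G (u n) (u m) (u m) <= 2 * c * (k ^+ n + k ^+ m).
  have kn i : 0 <= c * k ^+ i by rewrite mulr_ge0// exprn_ge0.
  have [nm|/ltnW mn] := leqP n m.
    have := tele n (m - n)%N; rewrite subnKC// => tn.
    by have := kn n; have := kn m; lra.
  have := tele m (n - m)%N; rewrite subnKC// => tn.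
  have k1' : 0 <= 1 - k by lra.
  have := ler_wpM2l k1' (Gmetric_swap_le (u n) (u m)).
  by have := kn n; have := kn m; lra.
apply/(cvg_nat2_0P R (fun n m => G (u n) (u m) (u m))) => e e0.
have kcvg : (GRing.exp k : nat -> R) @ \oo --> 0.
  by apply: cvg_expr; rewrite ger0_norm.
(* A rank past which both powers of [k] are small enough; the denominator uses
   [c + 1] because [c] may vanish. *)
have d0 : 0 < (1 - k) * e / (4 * (c + 1)).
  by rewrite divr_gt0 ?mulr_gt0//; lra.
have [N _ NP] := (cvgr0Pnorm_lt _).1 kcvg _ d0.
have {}NP n : (N <= n)%N -> 4 * (c + 1) * k ^+ n < (1 - k) * e.
  move=> /NP /=; rewrite ger0_norm ?exprn_ge0// ltr_pdivlMr; last by lra.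
  by rewrite mulrC.
exists N => n m /NP nP /NP mP; rewrite ger0_norm ?(Gmetric_ge0 HG)//.
rewrite -(@ltr_pM2l _ (1 - k)); last by lra.
apply: (le_lt_trans (bound n m)).
have := exprn_ge0 n k0; have := exprn_ge0 m k0; lra.
Qed.

(** Moving two arguments of [G l l y] one after the other from [l] to nearby
    points. *)
Lemma Gmetric_perturb2 l y p q :
  G l l y <= G p p l + G q q l + G p q y.
Proof.
have := Gmetric_triangle HG l l y p; have := Gmetric_triangle HG l p y q.
rewrite (GmetricR l p p) (GmetricR l q q) (GmetricCA l p y) (GmetricCA p q y).
lra.
Qed.

(** * The averaged condition and its fixed points *)

Definition averaged_Reich (T : X -> X) (b c : R) :=
  forall x y z, x <> y -> y <> z -> x <> z ->
    G (T x) (T y) (T z) <=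
      b * (G x (T x) (T x) + G y (T y) (T y) + G z (T z) (T z)) + c * G x y z.

Lemma Reich_averaged (T : X -> X) (a1 a2 a3 a4 : R) :
  (forall x y z : X, x <> y -> y <> z -> x <> z ->
     G (T x) (T y) (T z) <=
       a1 * G x (T x) (T x) + a2 * G y (T y) (T y)
       + a3 * G z (T z) (T z) + a4 * G x y z) ->
  averaged_Reich T ((a1 + a2 + a3) / 3) a4.
Proof.
move=> TG x y z xy yz xz.
have := TG x y z xy yz xz.
have := TG y z x yz (not_eq_sym xz) (not_eq_sym xy).
have := TG z x y (not_eq_sym xz) xy (not_eq_sym yz).
rewrite -(GmetricR x y z) -(GmetricR (T x) (T y) (T z)).
rewrite -(GmetricR y z x) -(GmetricR (T y) (T z) (T x)).
lra.
Qed.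

Definition perimeter (T : X -> X) y := G y (T y) (T (T y)).

Section AveragedReich.
Context (T : X -> X) (b c : R).
Context (b0 : 0 <= b) (c0 : 0 <= c) (bc1 : 3 * b + c < 1).
Context (TG : averaged_Reich T b c).

Lemma averaged_Reich_Fix_card : Fix T #<= `I_2.
Proof.
move: (b0) (bc1) => b_ge0 bc_lt1.
apply: card_le_I2 => x y z Tx Ty Tz xy yz xz.
have := TG _ _ _ xy yz xz; rewrite !(Tx, Ty, Tz).
have G0 t : G t t t = 0 by apply/(Gmetric_eq0 HG).
rewrite !G0 => le_c; have xyz := Gmetric_distinct_gt0 _ _ z xy.
have : 0 < (1 - c) * G x y z by rewrite mulr_gt0//; lra.
lra.
Qed.

Context (T_nofix : forall x, T x <> x) (T_no2cycle : forall x, T (T x) <> x).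

Let k := (2 * b + c) / (1 - b).

Let k_bounds : 0 <= k < 1.
Proof.
move: (b0) (c0) (bc1) => b_ge0 c_ge0 bc_lt1.
by rewrite divr_ge0 ?ltr_pdivrMr//=; lra.
Qed.

Lemma perimeter_gt0 y : 0 < perimeter T y.
Proof. by apply: Gmetric_distinct_gt0 => /esym; exact: T_nofix. Qed.

Lemma edge_le_perimeter y : G y (T y) (T y) <= perimeter T y.
Proof. by apply: Gmetric_edge_le => /esym; exact: T_no2cycle. Qed.

(** The edge from [T (T y)] is bounded by the perimeter of [T y], which
    is the quantity being estimated; absorbing it on the left accounts for the
    denominator [1 - b]. *)
Lemma perimeter_contract y : perimeter T (T y) <= k * perimeter T y.
Proof.
move: (b0) (c0) (bc1) => b_ge0 c_ge0 bc_lt1.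
rewrite /k mulrAC ler_pdivlMr; last by lra.
have := TG _ _ _ (not_eq_sym (T_nofix y)) (not_eq_sym (T_nofix (T y)))
  (not_eq_sym (T_no2cycle y)).
rewrite -/(perimeter T y) -/(perimeter T (T y)) => le1.
have e1 := ler_wpM2l b0 (edge_le_perimeter y).
have e2 : G (T y) (T (T y)) (T (T y)) <= perimeter T y.
  rewrite /perimeter -(GmetricR y (T y)).
  by apply: Gmetric_edge_le; exact: T_nofix.
have {}e2 := ler_wpM2l b0 e2.
have e3 : G (T (T y)) (T (T (T y))) (T (T (T y))) <= perimeter T (T y).
  rewrite /perimeter -(GmetricR (T y) (T (T y))).
  by apply: Gmetric_edge_le; exact: T_nofix.
have {}e3 := ler_wpM2l b0 e3.
lra.
Qed.

(** A repeated value would repeat its perimeter, but perimeters strictly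
    decrease along the orbit. *)
Lemma iter_inj x0 : injective (fun n => iter n T x0).
Proof.
have dec : {homo (fun n => perimeter T (iter n T x0)) :
    n m / (n < m)%N >-> m < n}.
  apply: homo_ltn => [y x z xy yz|n /=]; first exact: lt_trans yz xy.
  apply: (le_lt_trans (perimeter_contract _)).
  by rewrite gtr_pMl ?perimeter_gt0//; case/andP: k_bounds.
by move=> n m /= nm; have [lt|lt|//] := ltngtP n m; have := dec _ _ lt;
  rewrite /= nm ltxx.
Qed.

Lemma Gcauchy_iter x0 : Gcauchy G (fun n => iter n T x0).
Proof.
have k0 : 0 <= k by case/andP: k_bounds.
apply: (@Gcauchy_geometric _ k (perimeter T x0)) => //.
  exact: ltW (perimeter_gt0 _).
move=> n; apply: (le_trans (edge_le_perimeter _)).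
elim: n => [|n IH]; first by rewrite mul1r.
apply: (le_trans (perimeter_contract _)); rewrite exprS -mulrA.
exact: ler_wpM2l.
Qed.

(** A limit [l] would satisfy
    [G l l (T l) <= b * G l (T l) (T l) <= 2 * b * G l l (T l)] with
    [2 * b < 1], hence be a fixed point. *)
Lemma iter_not_Gconvergent x0 l : ~ Gconvergent G (fun n => iter n T x0) l.
Proof.
move: (b0) (c0) (bc1) => b_ge0 c_ge0 bc_lt1.
move=> /(cvg_nat2_0P R (fun n m => G (iter n T x0) (iter m T x0) l)) ul.
have [M neq_l] := inj_eventually_neq _ _ l (iter_inj x0).
set g := G l l (T l).
(* Every term that does not come from [g] is a multiple of [e]: at most 2 for
   moving [l] to the orbit, [6 * b < 2] for the two orbit edges and [c < 1] for
   [G p (T p) l]. So [(1 - 2 * b) * g <= 5 * e], where [1 / 3 < 1 - 2 * b]. *)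
have small (e : R) : 0 < e -> g <= 15 * e.
  move=> e0; have [N NP] := ul _ e0; pose n := maxn M N; pose p := iter n T x0.
  have Gl i j : (N <= i)%N -> (N <= j)%N -> G (iter i T x0) (iter j T x0) l < e.
    by move=> Ni Nj; apply: le_lt_trans (NP i j Ni Nj); exact: ler_norm.
  have Nn i : (N <= n + i)%N by rewrite (leq_trans (leq_maxr M N)) ?leq_addr.
  have Mn i : iter (n + i) T x0 <> l.
    by apply: neq_l; rewrite (leq_trans (leq_maxl M N)) ?leq_addr.
  have itE i : iter (n + i) T x0 = iter i T p by rewrite addnC iterD.
  have {}Gl i j : G (iter i T p) (iter j T p) l < e by rewrite -!itE; exact: Gl.
  have {}Mn i : iter i T p <> l by rewrite -itE.
  have edge i : G (iter i T p) (iter i.+1 T p) (iter i.+1 T p) <= 3 * e.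
    have := Gmetric_triangle HG (iter i T p) (iter i.+1 T p) (iter i.+1 T p) l.
    have := Gmetric_swap_le (iter i T p) l.
    rewrite -(GmetricR l (iter i T p)) -(GmetricR l (iter i.+1 T p)).
    by have := Gl i i; have := Gl i.+1 i.+1; lra.
  have := TG _ _ _ (not_eq_sym (T_nofix p)) (Mn 1%N) (Mn 0%N).
  have := Gmetric_perturb2 l (T l) (T p) (T (T p)).
  have := ler_wpM2l b0 (edge 0%N); have := ler_wpM2l b0 (edge 1%N).
  have := ler_wpM2l b0 (Gmetric_swap_le l (T l)).
  rewrite -(GmetricR (T l) l l).
  have := ler_wpM2l c0 (ltW (Gl 0%N 1%N)).
  have := Gl 1%N 1%N; have := Gl 2%N 2%N.
  have g_ge0 : 0 <= g by exact: Gmetric_ge0 HG _ _ _.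
  have be : 0 <= (1 / 3 - b) * e by rewrite mulr_ge0 ?(ltW e0)//; lra.
  have bg : 0 <= (1 / 3 - b) * g by rewrite mulr_ge0//; lra.
  have ce : 0 <= (1 - c) * e by rewrite mulr_ge0 ?(ltW e0)//; lra.
  rewrite /g /= in g_ge0 bg *; lra.
have g0 : 0 < g by exact: (Gmetric_gt0 HG (not_eq_sym (T_nofix l))).
have := small (g / 30); lra.
Qed.

End AveragedReich.
End GmetricTheory.

Theorem theorem3p7 (R : realType) (X : Type) (G : X -> X -> X -> R)
    (HG : is_Gmetric G) (Hcomplete : Gcomplete G)
    (HX : `I_3 #<= [set: X])
    (T : X -> X)
    (HT1 : forall x : X, T x <> x -> T (T x) <> x)
    (HT2 : exists a1 a2 a3 a4 : R,
      [/\ 0 <= a1, 0 <= a2, 0 <= a3 & 0 <= a4] /\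
      0 < a1 + a2 + a3 + a4 < 1 /\
      forall x y z : X, x <> y -> y <> z -> x <> z ->
        G (T x) (T y) (T z) <=
          a1 * G x (T x) (T x) + a2 * G y (T y) (T y)
          + a3 * G z (T z) (T z) + a4 * G x y z) :
  Fix T !=set0 /\ Fix T #<= `I_2.
Proof.
have [a1 [a2 [a3 [a4 [[p1 p2 p3 p4] [/andP[_ sum1] TG]]]]]] := HT2.
move/(Reich_averaged HG) in TG.
have b0 : 0 <= (a1 + a2 + a3) / 3 by lra.
have bc1 : 3 * ((a1 + a2 + a3) / 3) + a4 < 1 by lra.
split; last exact: (averaged_Reich_Fix_card HG _ _ _ b0 bc1 TG).
have [x0 _] : [set: X] !=set0.
  apply/set0P/eqP => X0; move: HX; rewrite X0 => /card_le0P I30.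
  by have : set0 0%N by rewrite -I30.
apply: contrapT => nofix.
have T_nofix x : T x <> x by move=> Tx; apply: nofix; exists x.
have T_no2cycle x : T (T x) <> x by exact/HT1/T_nofix.
have /Hcomplete[l] := Gcauchy_iter HG _ _ _ b0 p4 bc1 TG T_nofix T_no2cycle x0.
exact: (iter_not_Gconvergent HG _ _ _ b0 p4 bc1 TG T_nofix T_no2cycle).
Qed.
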